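(* Let $a>0$ be an integer and let $f_0$ be defined by $f_0(1)=1$, $f_0(2)=0$, and $f_0(n+2)=af_0(n)$ for $n\ge 1$. Then for every $n\ge 1$, the number $f_0(n)$ is the number of words of length $n-1$ over the alphabet $\{0,1,\ldots,a-1\}$ in which there are no runs of odd length.
   Context: A run in a word is a maximal block of consecutive equal letters. The empty word is the unique word of length $0$. *)

(* Defs.v *)
From mathcomp Require Import all_boot.

Set Implicit Arguments.
Unset Strict Implicit.
Unset Printing Implicit Defensive.

(* A block is given by its endpoints: [i, j) stands for the letters of w at
   the (0-based) positions i, ..., j - 1, so its length is j - i > 0. *)
Definition equal_block (T : eqType) (w : seq T) (i j : nat) : bool :=
  [&& i < j, j <= size w & constant (drop i (take j w))].

(* Maximality is with respect to inclusion of blocks.  Endpoints of blocks are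
   at most size w, so bounding the quantifiers here and below loses nothing. *)
Definition is_run (T : eqType) (w : seq T) (i j : nat) : bool :=
  equal_block w i j &&
  [forall i' : 'I_(size w).+1, forall j' : 'I_(size w).+1,
     [&& equal_block w i' j', i' <= i & j <= j'] ==> (i' == i :> nat) && (j' == j :> nat)].

Definition no_odd_run (T : eqType) (w : seq T) : bool :=
  [forall i : 'I_(size w).+1, forall j : 'I_(size w).+1,
     is_run w i j ==> ~~ odd (j - i)].

(* Main.v *)
Require Import Defs.
From mathcomp Require Import all_boot.

(** Cut a word at its two ends and between any two consecutive distinct
    letters.  The runs are exactly the blocks between consecutive cuts
    ([is_runP]), so every run has even length if and only if every cut is at an
    even position ([no_odd_runP]): going from left to right starting from the
    cut at 0, each run leads to a next cut of the same parity.  This condition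
    is local: prepending two letters [x], [y] creates a cut at 1 exactly when
    [x] and [y] differ, and shifts the other positive cuts by 2
    ([no_odd_run_cons2]).  So the words of length [n + 2] without odd runs are
    the words [x x s] with [x] any letter and [s] such a word of length [n],
    which is the recurrence defining [f0]; the initial values count the empty
    word and the words of length 1, whose only run has length 1. *)

Section Cuts.

Set Implicit Arguments.
Unset Strict Implicit.

Variable T : eqType.
Implicit Types (w s : seq T) (x y : T) (i j k : nat).

(** The optional lookup makes the end of a nonempty word a cut without a
    special case: there it compares a letter with [None]. *)
Definition cut w k := (k == 0) || (onth w k.-1 != onth w k).

Lemma cut_size w : cut w (size w).
Proof.
rewrite /cut; case: eqP => //= /eqP; rewrite -lt0n => w_gt0.
have := onthTE w (size w).-1; rewrite prednK // leqnn (onth_default (leqnn _)).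
by case: onth.
Qed.

Lemma cut_leq_size w k : cut w k -> k <= size w.
Proof.
case: k => // k; rewrite /cut leqNgt => h.
apply/negP => le_k; move: h.
by rewrite !onth_default ?eqxx //= leqW.
Qed.

Lemma constant_cutP w :
  reflect (forall k, 0 < k < size w -> ~~ cut w k) (constant w).
Proof.
elim: w => [|x [|y s] IH] /=; first by constructor; case.
  by constructor; case=> [|[]].
have -> : (y == x) && all (pred1 x) s = (y == x) && constant (y :: s).
  by case: eqP => //= ->.
apply: (iffP andP) => [[/eqP yx /IH nocut] [|[|k]] //|nocut].
- by rewrite /cut /= yx eqxx.
- by move=> lt_k; apply: (nocut k.+1).
split; last by apply/IH => [[|k]] // lt_k; apply: (nocut k.+2).
by have /(_ isT) := nocut 1; rewrite /cut /= negbK eq_sym.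
Qed.

Lemma cut_drop_take w i j k :
  0 < k -> i + k < j -> cut (drop i (take j w)) k = cut w (i + k).
Proof.
case: k => // k _; rewrite /cut addnS => lt_kj; rewrite !succnK !onthE.
by rewrite map_drop map_take !nth_drop !nth_take ?addnS // ltnW.
Qed.

Lemma equal_blockP w i j :
  reflect [/\ i < j, j <= size w & forall k, i < k < j -> ~~ cut w k]
          (equal_block w i j).
Proof.
have size_block : j <= size w -> size (drop i (take j w)) = j - i.
  by move=> le_j; rewrite size_drop size_takel.
apply: (iffP and3P) => -[lt_ij le_j nocut]; split=> //.
- move=> k /andP[lt_ik lt_kj].
  have k_gt0 : 0 < k - i by rewrite subn_gt0.
  have ikE := subnKC (ltnW lt_ik).
  rewrite -ikE -(@cut_drop_take _ _ j) ?ikE //.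
  by move/constant_cutP: nocut; apply; rewrite size_block // k_gt0 ltn_sub2r.
- apply/constant_cutP => k; rewrite size_block // ltn_subRL => /andP[k_gt0 lt_kj].
  by rewrite cut_drop_take //; apply: nocut; rewrite lt_kj -{1}[i]addn0 ltn_add2l k_gt0.
Qed.

(** An end of a block that is not a cut could be moved outwards by one, and a
    block strictly containing a block whose ends are cuts has a cut inside. *)
Lemma is_runP w i j :
  reflect [/\ i < j, cut w i, cut w j & forall k, i < k < j -> ~~ cut w k]
          (is_run w i j).
Proof.
apply: (iffP andP) => [[/equal_blockP[lt_ij le_j nocut] /'forall_forallP maxb]
                      |[lt_ij cut_i cut_j nocut]].
- have maximal i' j' : equal_block w i' j' -> i' <= i -> j <= j' ->
      i' = i /\ j' = j.
    move=> blk le_i le_j'; have [lt_i'j' le_j's _] := equal_blockP _ _ _ blk.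
    have lt_i's : i' < (size w).+1 by rewrite ltnS (leq_trans (ltnW lt_i'j')).
    have lt_j's : j' < (size w).+1 by [].
    have := maxb (Ordinal lt_i's) (Ordinal lt_j's).
    by rewrite /= blk le_i le_j' => /andP[/eqP-> /eqP->].
  split=> //.
  + apply/negPn/negP => ncut_i; have i_gt0 : 0 < i by case: (i) ncut_i.
    have [|||+ _] := maximal i.-1 j; rewrite ?leq_pred //.
      apply/equal_blockP; split=> // [|k /andP[le_ik lt_kj]].
        by rewrite (leq_ltn_trans (leq_pred _)).
      rewrite prednK // leq_eqVlt in le_ik.
      by case/orP: le_ik => [/eqP<-//|lt_ik]; apply: nocut; rewrite lt_ik.
    by move/eqP; rewrite -eqSS prednK // => /eqP/n_Sn.
  + apply/negPn/negP => ncut_j.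
    have lt_j : j < size w.
      by rewrite ltn_neqAle le_j andbT; apply: contraNneq ncut_j => ->; apply: cut_size.
    have [|||_ +] := maximal i j.+1; rewrite ?leqnSn //.
      apply/equal_blockP; split=> // [|k /andP[lt_ik le_kj]]; first exact: ltnW.
      rewrite ltnS leq_eqVlt in le_kj.
      by case/orP: le_kj => [/eqP->//|lt_kj]; apply: nocut; rewrite lt_ik.
    by move/esym/n_Sn.
- split; first by apply/equal_blockP; split=> //; apply: cut_leq_size.
  apply/'forall_forallP => i' j'; apply/implyP => /and3P[].
  move=> /equal_blockP[_ _ nocut'] le_i le_j; rewrite !eqn_leq le_i le_j andbT /=.
  apply/andP; split; rewrite leqNgt; apply/negP => lt.
    by have := nocut' i; rewrite lt cut_i (leq_trans lt_ij) // => /(_ isT).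
  by have := nocut' j; rewrite lt cut_j (leq_ltn_trans le_i) // => /(_ isT).
Qed.

Lemma no_odd_runP w :
  reflect (forall k, cut w k -> ~~ odd k) (no_odd_run w).
Proof.
apply: (iffP 'forall_forallP) => [even_run k|even_cut i j]; last first.
  apply/implyP => /is_runP[lt_ij /even_cut even_i /even_cut even_j _].
  by rewrite oddB ?(ltnW lt_ij) // (negPf even_i) (negPf even_j).
elim/ltn_ind: k => k IH cut_k; case: (posnP k) => [->//|k_gt0].
(* The run ending at [k] starts at the last cut before [k]. *)
have ex_cut : exists i, cut w i && (i < k) by exists 0.
have bounded i : cut w i && (i < k) -> i <= k by case/andP => _ /ltnW.
case: (ex_maxnP ex_cut bounded) => i /andP[cut_i lt_ik] max_i.
have run : is_run w i k.
  apply/is_runP; split=> // l /andP[lt_il lt_lk].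
  by apply/negP => cut_l; have := max_i l; rewrite cut_l lt_lk leqNgt lt_il => /(_ isT).
have lt_is : i < (size w).+1 by rewrite ltnS cut_leq_size.
have lt_ks : k < (size w).+1 by rewrite ltnS cut_leq_size.
have := even_run (Ordinal lt_is) (Ordinal lt_ks).
by rewrite /= run oddB ?(ltnW lt_ik) // (negPf (IH i lt_ik cut_i)) addbF.
Qed.

Lemma no_odd_run_nil : no_odd_run ([::] : seq T).
Proof. by apply/no_odd_runP => k /cut_leq_size; rewrite leqn0 => /eqP->. Qed.

Lemma no_odd_run_seq1 x : no_odd_run [:: x] = false.
Proof. by apply/no_odd_runP => /(_ 1 (cut_size [:: x])). Qed.

Lemma no_odd_run_cons2 x y s :
  no_odd_run (x :: y :: s) = (x == y) && no_odd_run s.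
Proof.
have cut1 : cut (x :: y :: s) 1 = (x != y) by [].
(* By conversion, [k.+1] is a cut of [s] iff [k.+3] is one of [x :: y :: s];
   the shift fails between 0 and 2, but these positions are even. *)
apply/no_odd_runP/andP => [even_cut|[/eqP xy /no_odd_runP even_cut]].
  split; first by apply/negPn/negP => /= ne_xy; have := even_cut 1 ne_xy.
  by apply/no_odd_runP => -[|k] // cut_k; rewrite -[odd _]negbK; apply: (even_cut k.+3).
case=> [|[|[|k]]] //; first by rewrite cut1 xy eqxx.
by move=> cut_k; rewrite /= negbK; apply: (even_cut k.+1).
Qed.

End Cuts.

Lemma card_no_odd_run_add2 (T : finType) (n : nat) :
  #|[set w : n.+2.-tuple T | no_odd_run w]| =
  #|T| * #|[set w : n.-tuple T | no_odd_run w]|.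
Proof.
pose double (p : T * n.-tuple T) := [tuple of p.1 :: p.1 :: p.2].
have double_inj : injective double.
  by move=> [x s] [y t] /(congr1 val)[-> _ /val_inj->].
rewrite -[#|T|]cardsT -cardsX -(card_imset _ double_inj); apply: eq_card => w.
rewrite inE; apply/idP/imsetP => [|[[x s]]]; last first.
  by rewrite !inE /= => even_s ->; rewrite no_odd_run_cons2 eqxx.
case/tupleP: w => x w; case/tupleP: w => y s.
rewrite no_odd_run_cons2 => /andP[/eqP-> even_s].
by exists (y, s); [rewrite !inE | apply: val_inj].
Qed.

Theorem proposition5 (a : nat) (ha : 0 < a) (f0 : nat -> nat)
    (hf1 : f0 1 = 1) (hf2 : f0 2 = 0)
    (hfrec : forall n : nat, 1 <= n -> f0 n.+2 = a * f0 n) :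
  forall n : nat, 1 <= n ->
    f0 n = #|[set w : (n - 1).-tuple 'I_a | no_odd_run w]|.
Proof.
case=> // n _; rewrite subn1 /=.
elim/ltn_ind: n => -[|[|n]] IH.
- rewrite hf1; apply/esym/eqP/cards1P; exists [tuple]; apply/setP => w.
  by rewrite !inE tuple0 no_odd_run_nil eqxx.
- rewrite hf2; apply/esym/eqP; rewrite cards_eq0; apply/eqP/setP => w.
  by rewrite !inE; case/tupleP: w => x w; rewrite tuple0 no_odd_run_seq1.
- by rewrite hfrec // card_no_odd_run_add2 card_ord IH.
Qed.
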